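(* There is a set-theoretic predicate $D(x,y)$ such that, for every set $z$, $D_z$ is not $\mathrm{SRM}^+$-computable in $D^z$.
   Context: Meta-theory: $\mathrm{ZFC}$ with a global well-ordering $<_\tau$ of $\mathrm V$ (a symbol added to the language of set theory) such that $\mathrm{rank}(x)<\mathrm{rank}(y)$ implies $x<_\tau y$. A set-theoretic predicate $D(x,y)$ is a predicate on $\mathrm V\times\mathrm V$ definable in this language, identified with its characteristic function $D:\mathrm V\times\mathrm V\to\{0,1\}$. For a set $z$, $D_z(x):=D(x,z)$, and $D^z$ is the predicate with $D^z(x,y):=D(x,y)$ if $y\neq z$ and $D^z(x,y):=0$ if $y=z$. Set register machines. An $\mathrm{SRM}^+$-program is a finite sequence $p=(p_1,\dots,p_m)$ of commands (program lines) acting on registers $R_0,\dots,R_k$ that contain sets. A configuration is $(l,r_0,\dots,r_k)$, with $l<\omega$ the active line and $r_i$ the content of $R_i$. If $1\le l\le m$, its successor is obtained by executing $p_l$; registers not mentioned as changed stay the same and the next active line is $l+1$ unless a jump occurs. The commands are: (i) ''$R_i:=\emptyset$''; (ii) $\mathtt{ADD}(i,j)$: replace $r_j$ by $r_j\cup\{r_i\}$; (iii) $\mathtt{COPY}(i,j)$: replace $r_j$ by $r_i$; (iv) $\mathtt{TAKE}(i,j)$: replace $r_j$ by the $<_\tau$-least element of $r_i$ (no change if $r_i=\emptyset$); (v) $\mathtt{REMOVE}(i,j)$: replace $r_j$ by $r_j\setminus\{r_i\}$; (vi) if $r_i=\emptyset$ go to line $n$; (vii) if $r_i\in r_j$ go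 to line $n$; (viii) $\mathtt{POW}(i,j)$: replace $r_j$ by $\mathcal P(r_i)$. A computation of $p$ on input $x_0,\dots,x_j$ is a sequence $(d_\beta)_{\beta\le\alpha}$ ($\alpha$ an ordinal) of configurations with $d_0=(1,x_0,\dots,x_j,\emptyset,\dots,\emptyset)$, $d_{\beta+1}$ the successor of $d_\beta$, for limit $\beta\le\alpha$ the active line and each register being the $\liminf$ of the earlier ones (for sets: $x\in\liminf_{\gamma<\beta}r_\gamma$ iff $x\in r_\gamma$ for all sufficiently large $\gamma<\beta$), and $d_\alpha$ having no successor (its active line is not in $\{1,\dots,m\}$). Then $p$ halts with output the content of $R_0$ in $d_\alpha$, denoted $p(x_0,\dots,x_j)$. Programs may use finitely many set parameters, treated as additional input in fixed registers; programs with parameters are coded as sets. Oracles. For a partial class function $O:\mathrm V\to\mathrm V$, $\mathrm{SRM}^{+,O}$-programs may in addition use the command $\mathtt{ORACLE}(i,j)$: if $O(r_i)$ is defined, replace $r_j$ by $O(r_i)$ and move to line $l+1$; if undefined, the configuration is left unchanged (so the machine loops). Functions of two arguments are queried on ordered pairs. A function $f$ is $\mathrm{SRM}^+$-computable in $g$ if there is an $\mathrm{SRM}^{+,g}$-program, possibly with parameters, computing $f$; a predicate is computable in $g$ if its characteristic function is. *)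

(* Defs.v *)
From Stdlib Require Import List.
Import ListNotations.

Record structure := Structure {
  carrier :> Type;
  mem : carrier -> carrier -> Prop;
  lt_tau : carrier -> carrier -> Prop
}.

Arguments mem {_} _ _.
Arguments lt_tau {_} _ _.

Declare Scope set_scope.
Notation "x ∈ y" := (mem x y) (at level 70) : set_scope.
Notation "x ≺ y" := (lt_tau x y) (at level 70) : set_scope.
Open Scope set_scope.

(** De Bruijn indices: index [0] refers to the innermost quantifier. *)
Inductive formula :=
| FMem (i j : nat)
| FEq (i j : nat)
| FLt (i j : nat)
| FNot (f : formula)
| FAnd (f g : formula)
| FOr (f g : formula)
| FImp (f g : formula)
| FAll (f : formula)
| FEx (f : formula).

Definition scons {A : Type} (x : A) (e : nat -> A) (n : nat) : A :=
  match n with 0 => x | S m => e m end.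

Fixpoint sat {V : structure} (e : nat -> V) (f : formula) : Prop :=
  match f with
  | FMem i j => e i ∈ e j
  | FEq i j => e i = e j
  | FLt i j => e i ≺ e j
  | FNot f => ~ sat e f
  | FAnd f g => sat e f /\ sat e g
  | FOr f g => sat e f \/ sat e g
  | FImp f g => sat e f -> sat e g
  | FAll f => forall x, sat (scons x e) f
  | FEx f => exists x, sat (scons x e) f
  end.

(** The binary predicate defined by [f]: index [0] is [x] and every other free
    index is [y], so no element of [V] other than the two arguments enters as
    a parameter. *)
Definition defined_by {V : structure} (f : formula) (x y : V) : Prop :=
  sat (scons x (fun _ => y)) f.

(** Every notion below quantifies over elements of the structure only, i.e. is
    the interpretation in [V] of the usual first-order definition.  "Natural
    number", "ordinal", "finite" and "function" therefore have the meaning they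
    have inside [V], also when [V] is not well-founded. *)

Section Sets.
Context {V : structure}.
Implicit Types x y z a b u v p q f i n : V.

Definition is_empty x := forall u, ~ u ∈ x.
Definition is_upair p a b := forall u, u ∈ p <-> u = a \/ u = b.
Definition is_pair p a b :=
  exists s t, is_upair s a a /\ is_upair t a b /\ is_upair p s t.
Definition is_adjoin y x a := forall u, u ∈ y <-> u ∈ x \/ u = a.
Definition is_remove y x a := forall u, u ∈ y <-> u ∈ x /\ u <> a.
Definition is_power y x := forall u, u ∈ y <-> forall v, v ∈ u -> v ∈ x.
Definition is_succ y x := is_adjoin y x x.
Definition is_least a x := a ∈ x /\ forall u, u ∈ x -> u <> a -> a ≺ u.

Definition transitive x := forall u v, u ∈ x -> v ∈ u -> v ∈ x.
Definition is_ordinal x := transitive x /\ forall y, y ∈ x -> transitive y.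
Definition is_limit x :=
  is_ordinal x /\ ~ is_empty x /\ forall y, ~ is_succ x y.
Definition is_natural n :=
  is_ordinal n /\
  forall u, u ∈ n \/ u = n -> is_empty u \/ exists v, is_succ u v.

Fixpoint is_numeral (n : nat) x : Prop :=
  match n with
  | 0 => is_empty x
  | S m => exists y, is_numeral m y /\ is_succ x y
  end.

Definition app f a b := exists p, is_pair p a b /\ p ∈ f.
Definition is_function f A :=
  (forall p, p ∈ f -> exists a b, is_pair p a b /\ a ∈ A) /\
  (forall a, a ∈ A -> exists! b, app f a b).

(** [rank u = \bigcup_(v ∈ u) (rank v + 1)], computed on a transitive set
    containing [x]. *)
Definition is_rank x r :=
  exists f t, transitive t /\ x ∈ t /\ is_function f t /\ app f x r /\
    forall u s, app f u s ->
      forall c, c ∈ s <->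
        exists v s', v ∈ u /\ app f v s' /\ (c ∈ s' \/ c = s').

(** Code of a finite list as an iterated ordered pair. *)
Fixpoint is_tuple x (l : list V) : Prop :=
  match l with
  | [] => is_empty x
  | a :: l' => exists y, is_tuple y l' /\ is_pair x a y
  end.

(** [F c w] reads "the [c]-th entry is [w]"; [y] is the set of those [u] that
    are in all entries from some index below [b] on. *)
Definition is_liminf y b (F : V -> V -> Prop) :=
  forall u, u ∈ y <->
    exists d, d ∈ b /\
      forall c w, c ∈ b -> d ∈ c \/ d = c -> F c w -> u ∈ w.

End Sets.

(** First-order models of ZFC with a global well-ordering: the schemes range over
    formulas (with parameters) in which the well-ordering may occur.  By
    completeness, truth in all these models is provability from the axioms. *)

Record ZFC_tau (V : structure) : Prop := {
  extensionality : forall x y : V, (forall u, u ∈ x <-> u ∈ y) -> x = y;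
  foundation : forall x : V,
    ~ is_empty x -> exists y, y ∈ x /\ forall u, u ∈ y -> ~ u ∈ x;
  pairing : forall a b : V, exists p, is_upair p a b;
  union : forall x : V, exists y, forall u, u ∈ y <-> exists v, u ∈ v /\ v ∈ x;
  powerset : forall x : V, exists y, is_power y x;
  infinity : exists w : V,
    (exists x, is_empty x /\ x ∈ w) /\
    forall x, x ∈ w -> exists y, is_succ y x /\ y ∈ w;
  separation : forall (f : formula) (e : nat -> V) (a : V),
    exists b, forall x, x ∈ b <-> x ∈ a /\ sat (scons x e) f;
  replacement : forall (f : formula) (e : nat -> V) (a : V),
    (forall x y y', x ∈ a ->
       sat (scons x (scons y e)) f -> sat (scons x (scons y' e)) f -> y = y') ->
    exists b, forall y, y ∈ b <-> exists x, x ∈ a /\ sat (scons x (scons y e)) f;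
  choice : forall a : V,
    (forall x, x ∈ a -> ~ is_empty x) ->
    exists f, is_function f a /\ forall x y, x ∈ a -> app f x y -> y ∈ x;
  tau_irreflexive : forall x : V, ~ x ≺ x;
  tau_transitive : forall x y z : V, x ≺ y -> y ≺ z -> x ≺ z;
  tau_total : forall x y : V, x ≺ y \/ x = y \/ y ≺ x;
  tau_well_founded : forall (f : formula) (e : nat -> V),
    (exists x, sat (scons x e) f) ->
    exists x, sat (scons x e) f /\ forall y, y ≺ x -> ~ sat (scons y e) f;
  tau_rank : forall x y r s : V,
    is_rank x r -> is_rank y s -> r ∈ s -> x ≺ y
}.

Section Machines.
Context {V : structure}.

(** Register indices and jump targets are elements of [V] because they range
    over the natural numbers of [V]. *)
Inductive command :=
| EMPTY (i : V)
| ADD (i j : V)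
| COPY (i j : V)
| TAKE (i j : V)
| REMOVE (i j : V)
| IF_EMPTY (i n : V)
| IF_MEM (i j n : V)
| POW (i j : V)
| ORACLE (i j : V).

Definition tagged (t : nat) (l : list V) (x : V) : Prop :=
  exists a, is_numeral t a /\ is_tuple x (a :: l).

Definition is_code (x : V) (c : command) : Prop :=
  match c with
  | EMPTY i => tagged 0 [i] x
  | ADD i j => tagged 1 [i; j] x
  | COPY i j => tagged 2 [i; j] x
  | TAKE i j => tagged 3 [i; j] x
  | REMOVE i j => tagged 4 [i; j] x
  | IF_EMPTY i n => tagged 5 [i; n] x
  | IF_MEM i j n => tagged 6 [i; j; n] x
  | POW i j => tagged 7 [i; j] x
  | ORACLE i j => tagged 8 [i; j] x
  end.

(** In what follows [k] is the index of the last register, so that the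
    registers are indexed by the elements of [k + 1]. *)
Definition is_register (k i : V) : Prop := i ∈ k \/ i = k.

Definition well_formed (k : V) (c : command) : Prop :=
  match c with
  | EMPTY i => is_register k i
  | ADD i j | COPY i j | TAKE i j | REMOVE i j | POW i j | ORACLE i j =>
      is_register k i /\ is_register k j
  | IF_EMPTY i n => is_register k i /\ is_natural n
  | IF_MEM i j n => is_register k i /\ is_register k j /\ is_natural n
  end.

(** A program is a function on [{1, ..., m}] whose values are codes of
    commands. *)
Definition is_program (k p : V) : Prop :=
  exists m L, is_natural m /\
    (forall l, l ∈ L <-> (l ∈ m \/ l = m) /\ ~ is_empty l) /\
    is_function p L /\
    forall l x, app p l x -> exists c, is_code x c /\ well_formed k c.

Definition is_configuration (k c : V) : Prop :=
  exists l r K, is_pair c l r /\ is_natural l /\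
    is_succ K k /\ is_function r K.

Definition is_update (r' r j y : V) : Prop :=
  forall i b, app r' i b <-> (i = j /\ b = y) \/ (i <> j /\ app r i b).

(** A partial class function is represented by its graph. *)
Definition execute (O : V -> V -> Prop) (c : command) (l r l' r' : V) : Prop :=
  match c with
  | EMPTY i =>
      is_succ l' l /\ exists y, is_empty y /\ is_update r' r i y
  | ADD i j =>
      is_succ l' l /\ exists a b y,
        app r i a /\ app r j b /\ is_adjoin y b a /\ is_update r' r j y
  | COPY i j =>
      is_succ l' l /\ exists a, app r i a /\ is_update r' r j a
  | TAKE i j =>
      is_succ l' l /\ exists a, app r i a /\
        ((is_empty a /\ r' = r) \/
         exists y, is_least y a /\ is_update r' r j y)
  | REMOVE i j =>
      is_succ l' l /\ exists a b y,
        app r i a /\ app r j b /\ is_remove y b a /\ is_update r' r j y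
  | IF_EMPTY i n =>
      r' = r /\ exists a, app r i a /\
        ((is_empty a /\ l' = n) \/ (~ is_empty a /\ is_succ l' l))
  | IF_MEM i j n =>
      r' = r /\ exists a b, app r i a /\ app r j b /\
        ((a ∈ b /\ l' = n) \/ (~ a ∈ b /\ is_succ l' l))
  | POW i j =>
      is_succ l' l /\ exists a y,
        app r i a /\ is_power y a /\ is_update r' r j y
  | ORACLE i j =>
      exists a, app r i a /\
        ((exists y, O a y /\ is_succ l' l /\ is_update r' r j y) \/
         ((~ exists y, O a y) /\ l' = l /\ r' = r))
  end.

Definition is_next (O : V -> V -> Prop) (p c c' : V) : Prop :=
  exists l r l' r' x cmd,
    is_pair c l r /\ is_pair c' l' r' /\
    app p l x /\ is_code x cmd /\ execute O cmd l r l' r'.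

Definition is_initial (k s c : V) : Prop :=
  exists l r, is_pair c l r /\ is_numeral 1 l /\
    forall i b, app r i b <->
      app s i b \/ (is_register k i /\ is_empty b /\ ~ exists a, app s i a).

Definition line_at (d b l : V) : Prop :=
  exists c r, app d b c /\ is_pair c l r.
Definition register_at (d i b x : V) : Prop :=
  exists c l r, app d b c /\ is_pair c l r /\ app r i x.

(** The input [s] is a finite sequence, indexed from [0], of length at most
    [k + 1].  The liminf of ordinals is [\bigcup_d \bigcap_(c >= d) l_c], so
    for the active lines, which are von Neumann naturals, it is an instance of
    the liminf of sets. *)
Definition is_computation (O : V -> V -> Prop) (k p s a d : V) : Prop :=
  is_ordinal a /\
  (exists A, is_succ A a /\ is_function d A) /\
  (forall b c, app d b c -> is_configuration k c) /\
  (exists b c, is_empty b /\ app d b c /\ is_initial k s c) /\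
  (forall b b' c c', b ∈ a -> is_succ b' b ->
     app d b c -> app d b' c' -> is_next O p c c') /\
  (forall b, is_limit b -> b ∈ a \/ b = a ->
     (forall l, line_at d b l -> is_liminf l b (line_at d)) /\
     (forall i x, register_at d i b x -> is_liminf x b (register_at d i))) /\
  (forall l, line_at d a l -> ~ exists x, app p l x).

Definition halts_with (O : V -> V -> Prop) (k p s y : V) : Prop :=
  exists a d i,
    is_computation O k p s a d /\ is_numeral 0 i /\ register_at d i a y.

(** [s] is the sequence [x, q_0, ..., q_(n-1)]. *)
Definition is_input (s x n q : V) : Prop :=
  exists N, is_succ N n /\ is_function s N /\
    (forall i, is_empty i -> app s i x) /\
    (forall i i' b, app q i b -> is_succ i' i -> app s i' b).

(** The sequence [q] of [n] parameters is additional input, stored in the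
    registers [R_1, ..., R_n]. *)
Definition computable_in (f g : V -> V -> Prop) : Prop :=
  exists k p n q,
    is_natural k /\ is_program k p /\
    is_natural n /\ is_register k n /\ is_function q n /\
    forall x y, f x y <-> exists s, is_input s x n q /\ halts_with g k p s y.

Definition char_value (P : Prop) (b : V) : Prop :=
  (P /\ is_numeral 1 b) \/ (~ P /\ is_numeral 0 b).

(** Graphs of the characteristic functions of a unary predicate and of a binary
    predicate, the latter as a function of an ordered pair. *)
Definition char1 (P : V -> Prop) (x b : V) : Prop := char_value (P x) b.
Definition char2 (P : V -> V -> Prop) (w b : V) : Prop :=
  exists x y, is_pair w x y /\ char_value (P x y) b.

(** [slice D z] is [D_z] and [erase D z] is [D^z]. *)
Definition slice (D : V -> V -> Prop) (z x : V) : Prop := D x z.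
Definition erase (D : V -> V -> Prop) (z x y : V) : Prop := y <> z /\ D x y.

End Machines.

Arguments command : clear implicits.

(* Main.v *)
Require Import Defs.
From Stdlib Require Import Classical.
From Stdlib Require List.
Import List.ListNotations.

(** The predicate is built by a Kleene-Post construction of length V.

    A task is a tuple [t = (z, k, p, n, q)]: a column [z] together with an
    oracle program [p] on registers [0..k] with parameter sequence [q] of
    length [n].  It is met when some [x] satisfies: [D x z] holds iff [p]
    on [x], with oracle [D^z], has a halting computation with output 0.  Such
    an [x] refutes that [p] computes the characteristic function of [D_z],
    since on [x] the value 0 is then output iff it is the wrong one.

    The tasks are handled along the global well-ordering.  A condition is a
    single set [Q]: it decides every ordered pair [w] with [w ≺ Q], making it
    true iff [w ∈ Q].  Because members precede sets ([mem_lt]), everything that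
    ever appears in a register during a computation [d] precedes [d], so [d]
    depends on the oracle only below [d] ([computation_local]): conditions
    beyond [d] settle whether [d] is a computation.  Given a condition [Q0]
    and a task, take [x := Q0]; the pair [w = (Q0, z)] is then undecided.  If some
    extension of [Q0] admits a halting computation on [x] with output 0, adopt it
    and make [w] true, which leaves the computation intact since the oracle
    [D^z] is 0 on column [z]; otherwise make [w] false
    ([extension_meets]).  The least suitable extension is chosen, so the
    construction is a definable recursion, and [D] is the union of all its
    stages.  In the second case no computation can appear at the end either,
    because it would already exist over the condition that records [D] below a
    large enough set ([truth_extension]).

    Three things support this inside an arbitrary model.  Definability is
    treated semantically and uniformly in the model ([definable]), so that one
    formula serves all of them.  Recursion along a set-like well-founded
    relation is proved once ([recursive_total]) and used for transitive
    closures, for ranks, and for the construction.  And proper initial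
    segments of the well-ordering are sets ([segment_exists]), because an initial
    segment is bounded in rank. *)

(** * Uniform definability *)

(** The formula is chosen before the model, which is what makes a single [D]
    possible; parameters are read from the environment. *)
Definition definable (P : forall V : structure, (nat -> V) -> Prop) : Prop :=
  exists f, forall (V : structure) (e : nat -> V), sat e f <-> P V e.

Lemma definable_iff (P Q : forall V : structure, (nat -> V) -> Prop) :
  (forall V e, Q V e <-> P V e) -> definable P -> definable Q.
Proof. intros H [f Hf]. exists f. intros V e. now rewrite H, Hf. Qed.

Lemma definable_mem i j : definable (fun V e => e i ∈ e j).
Proof. now exists (FMem i j). Qed.

Lemma definable_eq i j : definable (fun V e => e i = e j).
Proof. now exists (FEq i j). Qed.

Lemma definable_lt i j : definable (fun V e => e i ≺ e j).
Proof. now exists (FLt i j). Qed.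

Lemma definable_not P : definable P -> definable (fun V e => ~ P V e).
Proof. intros [f Hf]. exists (FNot f). intros V e. simpl. now rewrite Hf. Qed.

Lemma definable_and P Q :
  definable P -> definable Q -> definable (fun V e => P V e /\ Q V e).
Proof. intros [f Hf] [g Hg]. exists (FAnd f g). intros V e. simpl. now rewrite Hf, Hg. Qed.

Lemma definable_or P Q :
  definable P -> definable Q -> definable (fun V e => P V e \/ Q V e).
Proof. intros [f Hf] [g Hg]. exists (FOr f g). intros V e. simpl. now rewrite Hf, Hg. Qed.

Lemma definable_imp P Q :
  definable P -> definable Q -> definable (fun V e => P V e -> Q V e).
Proof. intros [f Hf] [g Hg]. exists (FImp f g). intros V e. simpl. now rewrite Hf, Hg. Qed.

Lemma definable_equiv P Q :
  definable P -> definable Q -> definable (fun V e => P V e <-> Q V e).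
Proof. intros HP HQ. apply definable_and; now apply definable_imp. Qed.

Lemma definable_ex (P : forall V : structure, V -> (nat -> V) -> Prop) :
  definable (fun V e => P V (e 0) (fun n => e (S n))) ->
  definable (fun V e => exists x, P V x e).
Proof.
  intros [f Hf]. exists (FEx f). intros V e. simpl.
  split; intros [x Hx]; exists x; apply (Hf V (scons x e)); exact Hx.
Qed.

Lemma definable_all (P : forall V : structure, V -> (nat -> V) -> Prop) :
  definable (fun V e => P V (e 0) (fun n => e (S n))) ->
  definable (fun V e => forall x, P V x e).
Proof.
  intros [f Hf]. exists (FAll f). intros V e. simpl.
  split; intros H x; apply (Hf V (scons x e)); apply H.
Qed.

(** Families of predicates that read parameters from the environment.
    Definability is required at all positions of the arguments and under all
    reindexings of the parameters, so that these notions can be used below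
    quantifiers, which shift the indices. *)
Definition definable1 (P : forall V : structure, (nat -> V) -> V -> Prop) : Prop :=
  forall r i, definable (fun V e => P V (fun n => e (r n)) (e i)).

Definition definable2 (P : forall V : structure, (nat -> V) -> V -> V -> Prop) : Prop :=
  forall r i j, definable (fun V e => P V (fun n => e (r n)) (e i) (e j)).

(** Decomposition along the syntax of a predicate.  Each notion of the model
    registers its own lemma, so it is not unfolded again where it is used. *)
Create HintDb definable.

Ltac definable_step :=
  cbv beta;
  first
   [ solve [auto 1 with definable nocore]
   | apply definable_and | apply definable_or | apply definable_not
   | apply definable_equiv
   | apply definable_ex | apply definable_all | apply definable_imp ].

Ltac definable := repeat definable_step.

#[export] Hint Resolve definable_mem definable_eq definable_lt : definable.

Lemma definable_is_empty i : definable (fun V e => is_empty (e i)).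
Proof. unfold is_empty. definable. Qed.

Lemma definable_is_upair i j k : definable (fun V e => is_upair (e i) (e j) (e k)).
Proof. unfold is_upair. definable. Qed.
#[export] Hint Resolve definable_is_empty definable_is_upair : definable.

Lemma definable_is_pair i j k : definable (fun V e => is_pair (e i) (e j) (e k)).
Proof. unfold is_pair. definable. Qed.
#[export] Hint Resolve definable_is_pair : definable.

Lemma definable_is_adjoin i j k : definable (fun V e => is_adjoin (e i) (e j) (e k)).
Proof. unfold is_adjoin. definable. Qed.
#[export] Hint Resolve definable_is_adjoin : definable.

Lemma definable_is_remove i j k : definable (fun V e => is_remove (e i) (e j) (e k)).
Proof. unfold is_remove. definable. Qed.
#[export] Hint Resolve definable_is_remove : definable.

Lemma definable_is_power i j : definable (fun V e => is_power (e i) (e j)).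
Proof. unfold is_power. definable. Qed.
#[export] Hint Resolve definable_is_power : definable.

Lemma definable_is_succ i j : definable (fun V e => is_succ (e i) (e j)).
Proof. unfold is_succ. definable. Qed.
#[export] Hint Resolve definable_is_succ : definable.

Lemma definable_is_least i j : definable (fun V e => is_least (e i) (e j)).
Proof. unfold is_least. definable. Qed.
#[export] Hint Resolve definable_is_least : definable.

Lemma definable_transitive i : definable (fun V e => transitive (e i)).
Proof. unfold transitive. definable. Qed.
#[export] Hint Resolve definable_transitive : definable.

Lemma definable_is_ordinal i : definable (fun V e => is_ordinal (e i)).
Proof. unfold is_ordinal. definable. Qed.
#[export] Hint Resolve definable_is_ordinal : definable.

Lemma definable_is_limit i : definable (fun V e => is_limit (e i)).
Proof. unfold is_limit. definable. Qed.
#[export] Hint Resolve definable_is_limit : definable.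

Lemma definable_is_natural i : definable (fun V e => is_natural (e i)).
Proof. unfold is_natural. definable. Qed.
#[export] Hint Resolve definable_is_natural : definable.

Lemma definable_app i j k : definable (fun V e => app (e i) (e j) (e k)).
Proof. unfold app. definable. Qed.
#[export] Hint Resolve definable_app : definable.

Lemma definable_is_function i j : definable (fun V e => is_function (e i) (e j)).
Proof. unfold is_function, unique. definable. Qed.
#[export] Hint Resolve definable_is_function : definable.

Lemma definable_is_rank i j : definable (fun V e => is_rank (e i) (e j)).
Proof. unfold is_rank. definable. Qed.
#[export] Hint Resolve definable_is_rank : definable.

Lemma definable_is_register i j : definable (fun V e => is_register (e i) (e j)).
Proof. unfold is_register. definable. Qed.
#[export] Hint Resolve definable_is_register : definable.

Lemma definable_is_configuration i j : definable (fun V e => is_configuration (e i) (e j)).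
Proof. unfold is_configuration. definable. Qed.
#[export] Hint Resolve definable_is_configuration : definable.

Lemma definable_is_update i j k l : definable (fun V e => is_update (e i) (e j) (e k) (e l)).
Proof. unfold is_update. definable. Qed.
#[export] Hint Resolve definable_is_update : definable.

Lemma definable_is_initial i j k : definable (fun V e => is_initial (e i) (e j) (e k)).
Proof. unfold is_initial, is_numeral. definable. Qed.
#[export] Hint Resolve definable_is_initial : definable.

Lemma definable_line_at i j k : definable (fun V e => line_at (e i) (e j) (e k)).
Proof. unfold line_at. definable. Qed.
#[export] Hint Resolve definable_line_at : definable.

Lemma definable_register_at i j k l :
  definable (fun V e => register_at (e i) (e j) (e k) (e l)).
Proof. unfold register_at. definable. Qed.
#[export] Hint Resolve definable_register_at : definable.

Lemma definable_is_input i j k l : definable (fun V e => is_input (e i) (e j) (e k) (e l)).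
Proof. unfold is_input. definable. Qed.
#[export] Hint Resolve definable_is_input : definable.

(** Commands are not elements of the model; a quantifier over them is a
    disjunction over the constructors, each quantifying over its arguments. *)
Lemma definable_ex_command
    (P : forall V : structure, command V -> (nat -> V) -> Prop) :
  definable (fun V e => exists i, P V (EMPTY i) e) ->
  definable (fun V e => exists i j, P V (ADD i j) e) ->
  definable (fun V e => exists i j, P V (COPY i j) e) ->
  definable (fun V e => exists i j, P V (TAKE i j) e) ->
  definable (fun V e => exists i j, P V (REMOVE i j) e) ->
  definable (fun V e => exists i n, P V (IF_EMPTY i n) e) ->
  definable (fun V e => exists i j n, P V (IF_MEM i j n) e) ->
  definable (fun V e => exists i j, P V (POW i j) e) ->
  definable (fun V e => exists i j, P V (ORACLE i j) e) ->
  definable (fun V e => exists c, P V c e).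
Proof.
  intros H0 H1 H2 H3 H4 H5 H6 H7 H8.
  refine (definable_iff _ _ _
    (definable_or _ _ H0 (definable_or _ _ H1 (definable_or _ _ H2
    (definable_or _ _ H3 (definable_or _ _ H4 (definable_or _ _ H5
    (definable_or _ _ H6 (definable_or _ _ H7 H8))))))))).
  intros V e; simpl. split.
  - intros [[] H]; eauto 12.
  - intros H. decompose [or ex] H; eauto.
Qed.

Section Computations.
Variable O : forall V : structure, (nat -> V) -> V -> V -> Prop.
Hypothesis HO : definable2 O.

Lemma definable_is_next r i j k :
  definable (fun V e => is_next (O V (fun n => e (r n))) (e i) (e j) (e k)).
Proof.
  unfold is_next. do 5 (apply definable_ex; cbv beta).
  apply definable_ex_command; unfold is_code, tagged; simpl; definable.
Qed.

Hint Resolve definable_is_next : definable.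

Lemma definable_is_computation r i j k l m :
  definable (fun V e =>
    is_computation (O V (fun n => e (r n))) (e i) (e j) (e k) (e l) (e m)).
Proof. unfold is_computation, is_liminf. definable. Qed.
End Computations.

(** * Pairs and functions in a model *)

Section Basics.
Context {V : structure} (HV : ZFC_tau V).

Lemma separation_for P (HP : definable1 P) (e : nat -> V) (a : V) :
  exists b, forall x, x ∈ b <-> x ∈ a /\ P V e x.
Proof.
  destruct (HP S 0) as [f Hf]. destruct (separation _ HV f e a) as [b Hb].
  exists b. intros x. now rewrite Hb, Hf.
Qed.

Lemma replacement_for P (HP : definable2 P) (e : nat -> V) (a : V) :
  (forall x y y', x ∈ a -> P V e x y -> P V e x y' -> y = y') ->
  exists b, forall y, y ∈ b <-> exists x, x ∈ a /\ P V e x y.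
Proof.
  destruct (HP (fun n => S (S n)) 0 1) as [f Hf]. intros H.
  destruct (replacement _ HV f e a) as [b Hb].
  - intros x y y' Hx. rewrite !Hf. now apply H.
  - exists b. intros y. rewrite Hb. now setoid_rewrite Hf.
Qed.

Lemma lt_minimal P (HP : definable1 P) (e : nat -> V) :
  (exists x, P V e x) -> exists x, P V e x /\ forall y, y ≺ x -> ~ P V e y.
Proof.
  destruct (HP S 0) as [f Hf]. intros H.
  destruct (tau_well_founded _ HV f e) as (x & Hx & Hm).
  - destruct H as [x Hx]. exists x. now apply Hf.
  - exists x. split; [now apply Hf in Hx|]. intros y Hy HP'. apply (Hm y Hy). now apply Hf.
Qed.

Lemma set_ext (x y : V) : (forall u, u ∈ x <-> u ∈ y) -> x = y.
Proof. apply (extensionality _ HV). Qed.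

Lemma empty_exists : exists x : V, is_empty x.
Proof. destruct (infinity _ HV) as [w [[x [Hx _]] _]]. now exists x. Qed.

Lemma upair_unique (p p' a b : V) : is_upair p a b -> is_upair p' a b -> p = p'.
Proof. intros H H'. apply set_ext. intros u. now rewrite (H u), (H' u). Qed.

Lemma upair_eq (p a b a' b' : V) : is_upair p a b -> is_upair p a' b' ->
  (a = a' /\ b = b') \/ (a = b' /\ b = a').
Proof.
  intros H H'. unfold is_upair in *.
  assert (E : forall u, u = a \/ u = b <-> u = a' \/ u = b')
    by (intros u; now rewrite <- H, <- H').
  pose proof (proj1 (E a) (or_introl eq_refl)).
  pose proof (proj1 (E b) (or_intror eq_refl)).
  pose proof (proj2 (E a') (or_introl eq_refl)).
  pose proof (proj2 (E b') (or_intror eq_refl)).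
  intuition congruence.
Qed.

Lemma pair_exists (a b : V) : exists p, is_pair p a b.
Proof.
  destruct (pairing _ HV a a) as [s Hs]. destruct (pairing _ HV a b) as [t Ht].
  destruct (pairing _ HV s t) as [p Hp]. exists p, s, t. auto.
Qed.

Lemma pair_unique (p p' a b : V) : is_pair p a b -> is_pair p' a b -> p = p'.
Proof.
  intros (s & t & Hs & Ht & Hp) (s' & t' & Hs' & Ht' & Hp').
  rewrite <- (upair_unique _ _ _ _ Hs Hs') in Hp'.
  rewrite <- (upair_unique _ _ _ _ Ht Ht') in Hp'.
  exact (upair_unique _ _ _ _ Hp Hp').
Qed.

Lemma pair_inj (p a b a' b' : V) : is_pair p a b -> is_pair p a' b' -> a = a' /\ b = b'.
Proof.
  intros (s & t & Hs & Ht & Hp) (s' & t' & Hs' & Ht' & Hp').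
  destruct (upair_eq _ _ _ _ _ Hp Hp') as [[<- <-]|[<- <-]].
  - destruct (upair_eq _ _ _ _ _ Hs Hs'), (upair_eq _ _ _ _ _ Ht Ht');
     intuition congruence.
  - destruct (upair_eq _ _ _ _ _ Hs Ht'), (upair_eq _ _ _ _ _ Ht Hs');
     intuition congruence.
Qed.

Lemma union2_exists (a b : V) : exists y, forall u, u ∈ y <-> u ∈ a \/ u ∈ b.
Proof.
  destruct (pairing _ HV a b) as [p Hp]. destruct (union _ HV p) as [y Hy].
  exists y. intros u. rewrite Hy. unfold is_upair in Hp. setoid_rewrite Hp.
  split; [intros (v & Hu & [->| ->])|intros []]; eauto.
Qed.

Lemma adjoin_exists (x a : V) : exists y, is_adjoin y x a.
Proof.
  destruct (pairing _ HV a a) as [p Hp]. destruct (union2_exists x p) as [y Hy].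
  exists y. intros u. rewrite Hy, (Hp u). tauto.
Qed.

Lemma mem_irrefl (x : V) : ~ x ∈ x.
Proof.
  intros H. destruct (pairing _ HV x x) as [p Hp].
  destruct (foundation _ HV p) as (y & Hy & Hm).
  - intros E. apply (E x), Hp. auto.
  - apply Hp in Hy. assert (y = x) as -> by tauto. apply (Hm x H), Hp. auto.
Qed.

Lemma function_exists P (HP : definable2 P) (e : nat -> V) (A : V) :
  (forall a, a ∈ A -> exists b, P V e a b) ->
  (forall a b b', a ∈ A -> P V e a b -> P V e a b' -> b = b') ->
  exists f, is_function f A /\ forall a b, app f a b <-> a ∈ A /\ P V e a b.
Proof.
  intros Htot Hfun.
  destruct (replacement_for (fun V e a p => exists b, is_pair p a b /\ P V e a b))
    with (e := e) (a := A) as [f Hf].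
  { intros r i j; definable. }
  { intros a p p' Ha (b & Hp & Hb) (b' & Hp' & Hb').
    rewrite <- (Hfun _ _ _ Ha Hb Hb') in Hp'. exact (pair_unique _ _ _ _ Hp Hp'). }
  assert (Happ : forall a b, app f a b <-> a ∈ A /\ P V e a b).
  { intros a b. unfold app. split.
    - intros (p & Hp & Hpf). apply Hf in Hpf. destruct Hpf as (a' & Ha' & b' & Hp' & Hb').
      destruct (pair_inj _ _ _ _ _ Hp Hp') as [-> ->]. now split.
    - intros [Ha Hb]. destruct (pair_exists a b) as [p Hp]. exists p. split; [exact Hp|].
      apply Hf. eauto. }
  exists f. split; [split|exact Happ].
  - intros p Hp. apply Hf in Hp. destruct Hp as (a & Ha & b & Hp & _). eauto.
  - intros a Ha. destruct (Htot a Ha) as [b Hb]. exists b. split.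
    + now apply Happ.
    + intros b' Hb'. apply Happ in Hb'. now apply (Hfun a).
Qed.

Lemma app_domain (f A a b : V) : is_function f A -> app f a b -> a ∈ A.
Proof.
  intros [H _] (p & Hp & Hpf). destruct (H p Hpf) as (a' & b' & Hp' & Ha).
  now destruct (pair_inj _ _ _ _ _ Hp Hp') as [-> _].
Qed.

Lemma app_total (f A a : V) : is_function f A -> a ∈ A -> exists b, app f a b.
Proof. intros [_ H] Ha. destruct (H a Ha) as (b & Hb & _). now exists b. Qed.

Lemma app_unique (f A a b b' : V) : is_function f A -> app f a b -> app f a b' -> b = b'.
Proof.
  intros Hf Hb Hb'. pose proof (app_domain _ _ _ _ Hf Hb) as Ha.
  destruct Hf as [_ H]. destruct (H a Ha) as (c & _ & Hc).
  rewrite <- (Hc b Hb). now apply Hc.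
Qed.

(** This turns the set existence questions in the recursions below into
    instances of separation. *)
Lemma values_exist (f : V) : exists Y, forall a b, app f a b -> b ∈ Y.
Proof.
  destruct (union _ HV f) as [X HX]. destruct (union _ HV X) as [Y HY].
  exists Y. intros a b (p & (s & t & _ & Ht & Hp) & Hpf). apply HY. exists t. split.
  - apply Ht. auto.
  - apply HX. exists p. split; [|exact Hpf]. apply Hp. auto.
Qed.
End Basics.

(** * Recursion along a well-founded relation *)

Section Recursion.
(** [G V c x A v] says that [v] is the value at [x] when [A] is the graph of the
    function on the [R]-predecessors of [x].  Passing a graph instead of a set
    lets the same [G] be applied to set approximations and to the resulting
    class function. *)
Variable R : forall V : structure, (nat -> V) -> V -> V -> Prop.
Variable G : forall V : structure, (nat -> V) -> V -> (V -> V -> Prop) -> V -> Prop.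
Hypothesis R_definable : definable2 R.
Hypothesis G_definable : forall r i j k,
  definable (fun V e => G V (fun n => e (r n)) (e i) (app (e j)) (e k)).

Definition closed_under (V : structure) (c : nat -> V) (T : V) : Prop :=
  forall u v, v ∈ T -> R V c u v -> u ∈ T.

Definition approximation (V : structure) (c : nat -> V) (f T : V) : Prop :=
  closed_under V c T /\ is_function f T /\ forall u v, app f u v -> G V c u (app f) v.

Definition recursive (V : structure) (c : nat -> V) (x v : V) : Prop :=
  exists f T, approximation V c f T /\ app f x v.

Lemma definable_recursive : definable2 recursive.
Proof. unfold recursive, approximation, closed_under. intros r i j. definable. Qed.

Record recursion_problem (V : structure) (c : nat -> V) : Prop := {
  R_closed : forall x, exists T, x ∈ T /\ closed_under V c T;
  R_minimal : forall S, ~ is_empty S ->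
    exists m, m ∈ S /\ forall u, u ∈ S -> ~ R V c u m;
  G_local : forall x (A B : V -> V -> Prop) v,
    (forall u w, R V c u x -> (A u w <-> B u w)) -> G V c x A v -> G V c x B v;
  G_unique : forall x A v v', G V c x A v -> G V c x A v' -> v = v';
  G_total : forall x f T, is_function f T ->
    (forall u, R V c u x -> u ∈ T) -> exists v, G V c x (app f) v
}.

Context {V : structure} (HV : ZFC_tau V) (c : nat -> V).
Hypothesis Hp : recursion_problem V c.

(** At an [R]-minimal disagreement both approximations have the same values on
    all predecessors, hence the same value. *)
Lemma approximations_agree f T f' T' x v v' :
  approximation V c f T -> approximation V c f' T' -> app f x v -> app f' x v' -> v = v'.
Proof.
  intros (HT & Hf & HG) (HT' & Hf' & HG') Hv Hv'.
  destruct (separation_for HV (fun V e u => u ∈ e 0 /\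
     exists v v', app (e 1) u v /\ app (e 2) u v' /\ v <> v')
     ltac:(intros r i; definable) (scons T' (scons f (fun _ => f'))) T) as [S HS].
  cbn in HS. apply NNPP. intros Hne.
  destruct (R_minimal _ _ Hp S) as (m & Hm & Hmin).
  { intros E. apply (E x), HS. repeat split.
    - now apply (app_domain f T x v).
    - now apply (app_domain f' T' x v').
    - now exists v, v'. }
  apply HS in Hm. destruct Hm as (HmT & HmT' & w & w' & Hw & Hw' & Hww).
  apply Hww. apply (G_unique _ _ Hp m (app f')); [|now apply HG'].
  apply (G_local _ _ Hp m (app f)); [|now apply HG].
  intros u a Hu. specialize (HT u m HmT Hu). specialize (HT' u m HmT' Hu).
  destruct (app_total f T u Hf HT) as [b Hb].
  destruct (app_total f' T' u Hf' HT') as [b' Hb'].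
  assert (b = b') as <-.
  { apply NNPP. intros Hbb. apply (Hmin u); [|exact Hu]. apply HS. eauto 10. }
  split; intros Ha.
  - now rewrite (app_unique f T u a b Hf Ha Hb).
  - now rewrite (app_unique f' T' u a b Hf' Ha Hb').
Qed.

Lemma recursive_unique x v v' : recursive V c x v -> recursive V c x v' -> v = v'.
Proof.
  intros (f & T & H & Hv) (f' & T' & H' & Hv').
  exact (approximations_agree f T f' T' x v v' H H' Hv Hv').
Qed.

Lemma approximation_recursive f T u w :
  approximation V c f T -> u ∈ T -> app f u w <-> recursive V c u w.
Proof.
  intros H Hu. split.
  - now exists f, T.
  - intros Hw. destruct (app_total f T u) as [w' Hw']; try apply H; auto.
    rewrite (recursive_unique u w w'); auto. now exists f, T.
Qed.

Lemma recursive_equation x v : recursive V c x v -> G V c x (recursive V c) v.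
Proof.
  intros (f & T & H & Hv). apply (G_local _ _ Hp x (app f)).
  - intros u w Hu. apply (approximation_recursive f T); auto.
    apply (proj1 H u x); auto. apply (app_domain f T x v); auto; apply H.
  - now apply H.
Qed.

Lemma recursive_closed u x v : recursive V c x v -> R V c u x -> exists w, recursive V c u w.
Proof.
  intros (f & T & H & Hv) Hu. destruct (app_total f T u) as [w Hw].
  - apply H.
  - apply (proj1 H u x); auto. apply (app_domain f T x v); auto; apply H.
  - exists w, f, T. auto.
Qed.

(** Inside a closed set, take an [R]-minimal [m] without value.  All values at
    points of that set that have one form an approximation, and [G_total]
    extends it by a value at [m]. *)
Lemma recursive_total x : exists v, recursive V c x v.
Proof.
  destruct (R_closed _ _ Hp x) as (T0 & HxT0 & HT0). apply NNPP. intros Hx.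
  assert (Hdef := definable_recursive).
  destruct (separation_for HV (fun V c u => ~ exists v, recursive V c u v)
     ltac:(intros r i; definable) c T0) as [S HS].
  destruct (R_minimal _ _ Hp S) as (m & Hm & Hmin).
  { intros E. apply (E x), HS. now split. }
  apply HS in Hm. destruct Hm as [HmT0 Hm].
  assert (Hpred : forall u, R V c u m -> u ∈ T0 /\ exists w, recursive V c u w).
  { intros u Hu. assert (u ∈ T0) by (apply (HT0 u m); auto). split; auto.
    apply NNPP. intros Hn. apply (Hmin u); auto. apply HS. auto. }
  destruct (separation_for HV (fun V c u => exists v, recursive V c u v)
     ltac:(intros r i; definable) c T0) as [T1 HT1].
  destruct (function_exists HV recursive Hdef c T1) as (f1 & Hf1 & Hf1app).
  { intros a Ha. now apply HT1. }
  { intros a b b' _. apply recursive_unique. }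
  destruct (G_total _ _ Hp m f1 T1 Hf1) as [v Hv].
  { intros u Hu. apply HT1, Hpred, Hu. }
  destruct (adjoin_exists HV T1 m) as [T2 HT2].
  destruct (function_exists HV (fun V e u w => recursive V (fun n => e (2 + n)) u w \/
     (u = e 0 /\ w = e 1)) ltac:(intros r i j; definable) (scons m (scons v c)) T2)
    as (f2 & Hf2 & Hf2app).
  { cbn. intros a Ha. apply HT2 in Ha as [Ha| ->]; [|now eauto].
    apply HT1 in Ha. destruct Ha as (_ & b & Hb). eauto. }
  { cbn. intros a b b' _ [Hb|[-> ->]] [Hb'|[Ea ->]]; subst; auto.
    - exact (recursive_unique _ _ _ Hb Hb').
    - destruct Hm; eauto.
    - destruct Hm; eauto. }
  cbn in Hf2app. change (fun n : nat => c n) with c in Hf2app.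
  assert (HT2' : forall u w, R V c u w -> w ∈ T2 -> u ∈ T1).
  { intros u w Hu Hw. apply HT1. apply HT2 in Hw as [Hw| ->]; [|now apply Hpred].
    apply HT1 in Hw. destruct Hw as (Hw & b & Hb). split.
    - now apply (HT0 u w).
    - exact (recursive_closed u w b Hb Hu). }
  assert (Hf2T1 : forall u w, u ∈ T1 -> app f2 u w <-> recursive V c u w).
  { intros u w Hu. rewrite Hf2app, (HT2 u). split; [|tauto].
    intros [_ [Hw|[-> _]]]; auto. apply HT1 in Hu. tauto. }
  apply Hm. exists v, f2, T2. split.
  - split; [|split; [exact Hf2|]].
    + intros u w Hw Hu. apply HT2. left. exact (HT2' u w Hu Hw).
    + intros u w Huw. assert (Hu : u ∈ T2) by now apply Hf2app in Huw.
      apply Hf2app in Huw. destruct Huw as [_ [Hw|[-> ->]]].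
      * apply (G_local _ _ Hp u (recursive V c)); [|now apply recursive_equation].
        intros a b Ha. symmetry. apply Hf2T1. exact (HT2' a u Ha Hu).
      * apply (G_local _ _ Hp m (app f1)); [|exact Hv].
        intros a b Ha. pose proof (HT2' a m Ha Hu) as HaT.
        rewrite (Hf2T1 a b HaT), Hf1app. tauto.
  - apply Hf2app. split; [apply HT2; auto|auto].
Qed.
End Recursion.

(** * Transitive closures, ranks and initial segments *)

(** Recursion on an inductive set [e 0] for the iterated unions of [e 1].  The
    clause at [n] collects all earlier stages at once, so that one clause
    covers zero and successors. *)
Definition within (V : structure) (e : nat -> V) (u v : V) : Prop :=
  u ∈ v /\ u ∈ e 0 /\ v ∈ e 0.

Definition collect_unions (V : structure) (e : nat -> V)
    (n : V) (A : V -> V -> Prop) (s : V) : Prop :=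
  forall a, a ∈ s <->
    a ∈ e 1 \/ exists m s' y, within V e m n /\ A m s' /\ y ∈ s' /\ a ∈ y.

Definition below (V : structure) (_ : nat -> V) (u v : V) : Prop := u ∈ v.

Definition rank_step (V : structure) (_ : nat -> V)
    (u : V) (A : V -> V -> Prop) (s : V) : Prop :=
  forall c, c ∈ s <-> exists v s', v ∈ u /\ A v s' /\ (c ∈ s' \/ c = s').

Section Ranks.
Context {V : structure} (HV : ZFC_tau V).

(** The union of the iterated unions of [x] is transitive, since the members of
    members of stage [n] appear at stage [n + 1]. *)
Lemma transitive_superset (x : V) : exists t, transitive t /\ x ∈ t.
Proof.
  destruct (infinity _ HV) as (w & (o & Ho & How) & Hw).
  set (c := scons w (fun _ => x)).
  assert (HR : definable2 within) by (intros r i j; unfold within; definable).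
  assert (HG : forall r i j k, definable (fun V e =>
    collect_unions V (fun n => e (r n)) (e i) (app (e j)) (e k)))
    by (intros r i j k; unfold collect_unions, within; definable).
  assert (Hp : recursion_problem within collect_unions V c).
  { split.
    - intros n. destruct (adjoin_exists HV w n) as [T HT]. exists T. split.
      + apply HT. auto.
      + intros u v _ (_ & Hu & _). apply HT. auto.
    - intros S HS. destruct (foundation _ HV S HS) as (m & Hm & Hmin).
      exists m. split; auto. intros u Hu [Hum _]. exact (Hmin u Hum Hu).
    - intros n A B s HAB Hs a. rewrite (Hs a). split; (intros [Ha|(m & s' & y & Hmn & HA & H)];
        [auto|right; exists m, s', y; split; [auto|split; [|exact H]]; now apply (HAB m s')]).
    - intros n A s s' Hs Hs'. apply (set_ext HV). intros u. now rewrite (Hs u), (Hs' u).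
    - intros n f T Hf Hn. destruct (values_exist HV f) as [Y HY].
      destruct (union _ HV Y) as [Z HZ]. destruct (union _ HV Z) as [Z' HZ'].
      destruct (union2_exists HV x Z') as [U HU].
      destruct (separation_for HV (fun V e a => a ∈ e 1 \/ exists m s' y,
         (m ∈ e 2 /\ m ∈ e 0 /\ e 2 ∈ e 0) /\ app (e 3) m s' /\ y ∈ s' /\ a ∈ y)
         ltac:(intros r i; definable) (scons w (scons x (scons n (fun _ => f)))) U)
         as [s Hs]. cbn in Hs.
      exists s. intros a. rewrite Hs. cbn. split; [tauto|]. intros H. split; [|exact H].
      apply HU. destruct H as [H|(m & s' & y & _ & Hms & Hy & Ha)]; [auto|right].
      apply HZ'. exists y. split; auto. apply HZ. exists s'. split; auto.
      exact (HY _ _ Hms). }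
  pose proof (recursive_total _ _ HR HG HV c Hp) as Htot.
  pose proof (recursive_unique _ _ HV c Hp) as Hun.
  pose proof (recursive_equation _ _ HV c Hp) as Heq.
  pose proof (definable_recursive _ _ HR HG) as Hdef.
  destruct (replacement_for HV _ Hdef c w) as [Y HY].
  { intros n s s' _. apply Hun. }
  destruct (union _ HV Y) as [t Ht].
  assert (Hxt : forall u, u ∈ x -> u ∈ t).
  { intros u Hu. destruct (Htot o) as [s Hs]. apply Ht. exists s. split.
    - apply (Heq _ _ Hs). auto.
    - apply HY. eauto. }
  assert (Htt : transitive t).
  { intros u v Hu Hv. apply Ht in Hu. destruct Hu as (s & Hus & Hs).
    apply HY in Hs. destruct Hs as (n & Hn & Hs).
    destruct (Hw n Hn) as (n' & Hn' & Hn'w). destruct (Htot n') as [s' Hs'].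
    apply Ht. exists s'. split; [|apply HY; eauto].
    apply (Heq _ _ Hs'). right. exists n, s, u. repeat split; auto.
    apply Hn'. auto. }
  destruct (adjoin_exists HV t x) as [t' Ht']. exists t'. split.
  - intros u v Hu Hv. apply Ht'. left. apply Ht' in Hu as [Hu| ->]; eauto.
  - apply Ht'. auto.
Qed.

(** Foundation for classes, by applying foundation to the part of the class
    inside a transitive set. *)
Lemma mem_minimal P (HP : definable1 P) (e : nat -> V) :
  (exists x, P V e x) -> exists x, P V e x /\ forall y, y ∈ x -> ~ P V e y.
Proof.
  intros [x Hx]. destruct (transitive_superset x) as (t & Ht & Hxt).
  destruct (separation_for HV P HP e t) as [S HS].
  destruct (foundation _ HV S) as (m & Hm & Hmin).
  { intros E. apply (E x), HS. auto. }
  apply HS in Hm. destruct Hm as [Hmt Hm]. exists m. split; auto.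
  intros y Hy HPy. apply (Hmin y Hy), HS. split; auto. exact (Ht m y Hmt Hy).
Qed.

Lemma mem_induction P (HP : definable1 P) (e : nat -> V) :
  (forall x, (forall y, y ∈ x -> P V e y) -> P V e x) -> forall x, P V e x.
Proof.
  intros H. apply NNPP. intros Hn.
  destruct (mem_minimal (fun V e x => ~ P V e x)) with (e := e) as (x & Hx & Hmin).
  - intros r i. definable.
  - apply NNPP. intros Hn'. apply Hn. intros x. apply NNPP. eauto.
  - apply Hx, H. intros y Hy. apply NNPP. exact (Hmin y Hy).
Qed.

Lemma mem_induction_closed (P : forall V : structure, V -> Prop) :
  definable1 (fun V _ => P V) ->
  (forall x : V, (forall y, y ∈ x -> P V y) -> P V x) -> forall x, P V x.
Proof. intros HP H x. exact (mem_induction _ HP (fun _ => x) H x). Qed.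

(** The witnesses in [is_rank] are exactly the approximations of the recursion
    that computes ranks along membership, with transitive domains. *)
Lemma rank_recursion : (forall x : V, exists r, is_rank x r) /\
  (forall x r : V, is_rank x r -> forall c, c ∈ r <->
     exists v s, v ∈ x /\ is_rank v s /\ (c ∈ s \/ c = s)).
Proof.
  destruct (empty_exists HV) as [o _]. set (c := fun _ : nat => o).
  assert (HR : definable2 below) by (intros r i j; unfold below; definable).
  assert (HG : forall r i j k, definable (fun V e =>
    rank_step V (fun n => e (r n)) (e i) (app (e j)) (e k)))
    by (intros r i j k; unfold rank_step; definable).
  assert (Hp : recursion_problem below rank_step V c).
  { split.
    - intros x. destruct (transitive_superset x) as (t & Ht & Hxt). exists t.
      split; auto. intros u v Hv Hu. exact (Ht v u Hv Hu).
    - intros S HS. destruct (foundation _ HV S HS) as (m & Hm & Hmin).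
      exists m. split; auto. intros u Hu Hum. exact (Hmin u Hum Hu).
    - intros x A B s HAB Hs a. rewrite (Hs a).
      split; intros (v & s' & Hv & HA & H); exists v, s';
        (split; [auto|split; [|exact H]]; now apply (HAB v s')).
    - intros n A s s' Hs Hs'. apply (set_ext HV). intros u. now rewrite (Hs u), (Hs' u).
    - intros x f T Hf Hx. destruct (values_exist HV f) as [Y HY].
      destruct (union _ HV Y) as [Z HZ]. destruct (union2_exists HV Y Z) as [U HU].
      destruct (separation_for HV (fun V e a => exists v s',
         v ∈ e 0 /\ app (e 1) v s' /\ (a ∈ s' \/ a = s'))
         ltac:(intros r i; definable) (scons x (fun _ => f)) U) as [s Hs]. cbn in Hs.
      exists s. intros a. rewrite Hs. split; [tauto|]. intros H. split; [|exact H].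
      apply HU. destruct H as (v & s' & _ & Hvs & [Ha| ->]); [right|left; eauto].
      apply HZ. eauto. }
  assert (Hrank : forall x r, is_rank x r <-> recursive below rank_step V c x r).
  { intros x r. unfold is_rank, recursive, approximation, closed_under, below, rank_step.
    split.
    - intros (f & t & Ht & Hx & Hf & Hr & Heq). exists f, t. repeat split; auto; try apply Hf.
      + intros u v Hv Hu. exact (Ht v u Hv Hu).
      + now apply Heq.
      + now apply Heq.
    - intros (f & t & (Ht & Hf & Heq) & Hr). exists f, t. repeat split; auto; try apply Hf.
      + intros u v Hu Hv. exact (Ht v u Hu Hv).
      + exact (app_domain _ _ _ _ Hf Hr).
      + now apply Heq.
      + now apply Heq. }
  repeat split.
  - intros x. destruct (recursive_total _ _ HR HG HV c Hp x) as [r Hr].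
    exists r. now apply Hrank.
  - intros Hc. apply Hrank in H. apply (recursive_equation _ _ HV c Hp) in H.
    apply H in Hc. destruct Hc as (v & s & Hv & Hs & Hc). apply Hrank in Hs. eauto.
  - intros (v & s & Hv & Hs & Hc). apply Hrank in H, Hs.
    apply (recursive_equation _ _ HV c Hp) in H. apply H. eauto.
Qed.

Lemma rank_exists (x : V) : exists r, is_rank x r.
Proof. apply rank_recursion. Qed.

Lemma rank_equation (x r : V) : is_rank x r -> forall c, c ∈ r <->
  exists v s, v ∈ x /\ is_rank v s /\ (c ∈ s \/ c = s).
Proof. apply rank_recursion. Qed.

Lemma rank_ordinal (x r : V) : is_rank x r -> is_ordinal r.
Proof.
  revert x r. apply (mem_induction_closed (fun V x => forall r, is_rank x r -> is_ordinal r)).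
  - intros r i. definable.
  - intros x IH r Hr. pose proof (rank_equation x r Hr) as Heq. split.
    + intros u v Hu Hv. apply Heq in Hu. destruct Hu as (y & s & Hy & Hs & Hu).
      apply Heq. exists y, s. repeat split; auto. left.
      destruct Hu as [Hu| ->]; [|exact Hv]. exact (proj1 (IH y Hy s Hs) u v Hu Hv).
    + intros u Hu. apply Heq in Hu. destruct Hu as (y & s & Hy & Hs & Hu).
      specialize (IH y Hy s Hs).
      destruct Hu as [Hu| ->]; [exact (proj2 IH u Hu)|exact (proj1 IH)].
Qed.

Lemma ordinal_member (a b : V) : is_ordinal a -> b ∈ a -> is_ordinal b.
Proof.
  intros [Ht Ha] Hb. split; [now apply Ha|]. intros y Hy. apply Ha. exact (Ht b y Hb Hy).
Qed.

Lemma ordinal_trichotomy (a b : V) :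
  is_ordinal a -> is_ordinal b -> a ∈ b \/ a = b \/ b ∈ a.
Proof.
  revert a b. apply (mem_induction_closed (fun V a => forall b, is_ordinal a ->
    is_ordinal b -> a ∈ b \/ a = b \/ b ∈ a)).
  1: intros r i; definable.
  intros a IHa b Ha. revert b.
  refine (mem_induction (fun V e b => is_ordinal b -> e 0 ∈ b \/ e 0 = b \/ b ∈ e 0)
    ltac:(intros r i; definable) (fun _ => a) _); cbn.
  intros b IHb Hb. apply NNPP. intros Hn.
  apply Hn. right; left. apply (set_ext HV). intros u. split; intros Hu.
  - destruct (IHa u Hu b (ordinal_member a u Ha Hu) Hb) as [H|[->|H]]; auto; destruct Hn.
    + now right; right.
    + right; right. exact (proj1 Ha u b Hu H).
  - destruct (IHb u Hu (ordinal_member b u Hb Hu)) as [H|[<-|H]]; auto; destruct Hn.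
    + left. exact (proj1 Hb u a Hu H).
    + now left.
Qed.

(** The link between membership and the well-ordering, and the reason why the
    order itself can measure how much of an oracle a computation uses. *)
Lemma mem_lt (x y : V) : x ∈ y -> x ≺ y.
Proof.
  intros H. destruct (rank_exists x) as [r Hr], (rank_exists y) as [s Hs].
  apply (tau_rank _ HV x y r s Hr Hs). apply (rank_equation y s Hs). exists x, r. auto.
Qed.

(** This is the level of the cumulative hierarchy just above the rank of [x].
    Induction on [x]: the members of a [u] of rank at most that of [x] have
    rank at most that of some member of [x], so [u] is a subset of the union
    of the levels that belong to the members of [x]. *)
Lemma rank_bounded_set (x : V) : exists S, forall u, u ∈ S <->
  exists r s, is_rank u r /\ is_rank x s /\ ~ s ∈ r.
Proof.
  revert x. apply (mem_induction_closed (fun V x => exists S, forall u, u ∈ S <->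
    exists r s, is_rank u r /\ is_rank x s /\ ~ s ∈ r)).
  1: intros r i; definable.
  intros x IH.
  destruct (replacement_for HV (fun V _ v S => forall u, u ∈ S <->
    exists r s, is_rank u r /\ is_rank v s /\ ~ s ∈ r)
    ltac:(intros r i j; definable) (fun _ => x) x) as [Y HY].
  { intros v S S' _ HS HS'. apply (set_ext HV). intros u. now rewrite HS, HS'. }
  destruct (union _ HV Y) as [Z HZ]. destruct (powerset _ HV Z) as [W HW].
  destruct (separation_for HV (fun V e u =>
    exists r s, is_rank u r /\ is_rank (e 0) s /\ ~ s ∈ r)
    ltac:(intros r i; definable) (fun _ => x) W) as [S HS]. cbn in HS.
  exists S. intros u. rewrite HS. split; [tauto|]. intros H. split; [|exact H].
  destruct H as (r & s & Hr & Hs & Hrs). apply HW. intros w Hw.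
  apply NNPP. intros HwZ. apply Hrs.
  destruct (rank_exists w) as [q Hq].
  pose proof (rank_ordinal _ _ Hs) as Hso. pose proof (rank_ordinal _ _ Hq) as Hqo.
  assert (Hqr : q ∈ r) by (apply (rank_equation u r Hr); exists w, q; auto).
  pose proof (rank_ordinal _ _ Hr) as Hro.
  assert (Hsq : forall c, c ∈ s -> c ∈ q).
  { intros c Hc. apply (rank_equation x s Hs) in Hc. destruct Hc as (v & p & Hv & Hp & Hc).
    assert (Hpq : p ∈ q).
    { apply NNPP. intros Hpq. apply HwZ. destruct (IH v Hv) as [Sv HSv].
      apply HZ. exists Sv. split; [apply HSv; exists q, p; auto|]. apply HY. eauto. }
    destruct Hc as [Hc| ->]; auto. exact (proj1 Hqo p c Hpq Hc). }
  destruct (ordinal_trichotomy s q Hso Hqo) as [H|[->|H]]; auto.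
  - exact (proj1 Hro q s Hqr H).
  - destruct (mem_irrefl HV q). auto.
Qed.

(** A predecessor of [x] cannot have larger rank than [x]. *)
Lemma segment_exists (x : V) : exists S, forall u, u ∈ S <-> u ≺ x.
Proof.
  destruct (rank_bounded_set x) as [S0 HS0].
  destruct (separation_for HV (fun V e u => u ≺ e 0) ltac:(intros r i; definable)
    (fun _ => x) S0) as [S HS].
  exists S. intros u. rewrite HS. split; [tauto|]. intros H. split; [|exact H].
  apply HS0. destruct (rank_exists u) as [r Hr], (rank_exists x) as [s Hs].
  exists r, s. repeat split; auto. intros Hsr.
  apply (tau_irreflexive _ HV u). apply (tau_transitive _ HV u x u H).
  exact (tau_rank _ HV x u s r Hs Hr Hsr).
Qed.
End Ranks.

(** * Locality of computations *)

Section Locality.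
Context {V : structure} (HV : ZFC_tau V).
Implicit Types w x y z a b c d l r i k p q n s t u : V.

Lemma lt_trans x y z : x ≺ y -> y ≺ z -> x ≺ z.
Proof. apply (tau_transitive _ HV). Qed.

Lemma lt_irrefl x : ~ x ≺ x.
Proof. apply (tau_irreflexive _ HV). Qed.

Lemma not_lt x y : ~ x ≺ y -> y = x \/ y ≺ x.
Proof. destruct (tau_total _ HV x y) as [H|[H|H]]; auto. tauto. Qed.

Lemma pair_lt p a b : is_pair p a b -> a ≺ p /\ b ≺ p.
Proof.
  intros (s & t & Hs & Ht & Hp).
  assert (t ≺ p) by (apply (mem_lt HV), Hp; auto).
  split; apply (lt_trans _ t); auto; apply (mem_lt HV), Ht; auto.
Qed.

Lemma app_lt f a b : app f a b -> b ≺ f.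
Proof.
  intros (p & Hp & Hpf). apply (lt_trans _ p).
  - apply (pair_lt p a b Hp).
  - now apply (mem_lt HV).
Qed.

(** Contents of registers lie in the transitive closure of the computation. *)
Lemma register_lt d b c l r i a : app d b c -> is_pair c l r -> app r i a -> a ≺ d.
Proof.
  intros Hd Hc Hr. apply (lt_trans _ r); [exact (app_lt r i a Hr)|].
  apply (lt_trans _ c); [apply (pair_lt c l r Hc)|exact (app_lt d b c Hd)].
Qed.

(** Oracle queries are contents of registers, hence precede the computation. *)
Lemma computation_local (O O' : V -> V -> Prop) k p s a d :
  (forall w, w ≺ d -> forall b, O w b <-> O' w b) ->
  is_computation O k p s a d -> is_computation O' k p s a d.
Proof.
  intros HO (H1 & H2 & H3 & H4 & H5 & H6 & H7). repeat (split; [assumption|]).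
  split; [|split; assumption].
  intros b b' c c' Hb Hb' Hc Hc'.
  destruct (H5 b b' c c' Hb Hb' Hc Hc')
    as (l & r & l' & r' & x & cmd & Hcl & Hcl' & Hx & Hcmd & Hex).
  exists l, r, l', r', x, cmd. repeat (split; [assumption|]).
  destruct cmd; try exact Hex. destruct Hex as (v & Hv & Hex). exists v. split; [exact Hv|].
  specialize (HO v (register_lt d b c l r i v Hc Hcl Hv)).
  setoid_rewrite <- HO. exact Hex.
Qed.
End Locality.

(** * Conditions and the construction *)

Section Conditions.
Context {V : structure}.
Implicit Types w x y z b d k p q n t u Q : V.

(** The oracle [D^z], where [P] is the set or class of codes of the pairs in
    [D]. *)
Definition oracle (P : V -> Prop) z w b : Prop :=
  exists x y, is_pair w x y /\ char_value (y <> z /\ P w) b.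

(** The computation [d] is an argument because its position in the well-ordering
    bounds the part of [P] that it uses. *)
Definition outputs_zero z k p n q x (P : V -> Prop) d : Prop :=
  exists s a i y, is_input s x n q /\ is_computation (oracle P z) k p s a d /\
    is_empty i /\ register_at d i a y /\ is_empty y.

(** A condition [Q] decides the pairs [w ≺ Q], by membership; every set is a
    condition. *)
Definition extends Q Q' : Prop := ~ Q' ≺ Q /\ forall w, w ≺ Q -> (w ∈ Q' <-> w ∈ Q).

(** When [w] is made false, all extensions of [Q] have to be excluded, since the
    final predicate is only known to extend [Q]. *)
Definition meets z k p n q Q : Prop :=
  exists x w, is_pair w x z /\ w ≺ Q /\
    ((w ∈ Q /\ exists d, d ≺ Q /\ outputs_zero z k p n q x (fun u => u ∈ Q) d) \/
     (~ w ∈ Q /\ forall Q' d, extends Q Q' -> d ≺ Q' ->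
        ~ outputs_zero z k p n q x (fun u => u ∈ Q') d)).

Definition suitable t (A : V -> V -> Prop) Q : Prop :=
  (forall u Q', u ≺ t -> A u Q' -> extends Q' Q) /\
  forall z k p n q, is_tuple t [z; k; p; n; q] -> meets z k p n q Q.

(** The second alternative makes [step] total for arbitrary graphs [A]; along the
    construction the first one holds ([stage_suitable]). *)
Definition acceptable t (A : V -> V -> Prop) Q : Prop :=
  suitable t A Q \/ ~ exists Q', suitable t A Q'.

Definition step t (A : V -> V -> Prop) Q : Prop :=
  acceptable t A Q /\ forall Q', Q' ≺ Q -> ~ acceptable t A Q'.
End Conditions.

Definition precedes (V : structure) (_ : nat -> V) (u t : V) : Prop := u ≺ t.

Definition stage {V : structure} (t Q : V) : Prop :=
  recursive precedes (fun V _ => step) V (fun _ => t) t Q.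

Definition truth {V : structure} (w : V) : Prop := exists t Q, stage t Q /\ w ∈ Q.

Lemma definable_outputs_zero i j k l m n o q : definable (fun V e =>
  outputs_zero (e i) (e j) (e k) (e l) (e m) (e n) (fun u => u ∈ e o) (e q)).
Proof.
  unfold outputs_zero.
  do 4 (apply definable_ex; cbv beta). apply definable_and; [definable|].
  apply definable_and; [|definable].
  refine (definable_is_computation
    (fun V e w b => exists x y, is_pair w x y /\ char_value (y <> e 0 /\ w ∈ e 1) b)
    _ (fun n => match n with 0 => S (S (S (S i))) | _ => S (S (S (S o))) end) _ _ _ _ _).
  unfold char_value. simpl. intros r i' j'. definable.
Qed.

Lemma definable_meets i j k l m n : definable (fun V e =>
  meets (e i) (e j) (e k) (e l) (e m) (e n)).
Proof.
  pose proof definable_outputs_zero. unfold meets, extends. definable.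
Qed.

Lemma definable_suitable A (HA : definable2 A) r i j :
  definable (fun V e => suitable (e i) (A V (fun n => e (r n))) (e j)).
Proof.
  pose proof definable_meets. unfold suitable, extends. simpl. definable.
Qed.

Lemma definable_suitable_app i j k : definable (fun V e => suitable (e i) (app (e j)) (e k)).
Proof.
  refine (definable_suitable (fun V e => app (e 0)) _ (fun _ => j) i k).
  intros r i' j'. definable.
Qed.
#[export] Hint Resolve definable_suitable_app : definable.

Lemma definable_step_app i j k : definable (fun V e => step (e i) (app (e j)) (e k)).
Proof. unfold step, acceptable. definable. Qed.

Lemma definable_stage i j : definable (fun V e => stage (e i) (e j)).
Proof.
  refine (definable_recursive precedes (fun V _ => step) _ _ (fun n => n) i j).
  - intros r i' j'. apply definable_lt.
  - intros _. exact definable_step_app.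
Qed.
#[export] Hint Resolve definable_stage : definable.

Lemma definable_suitable_stage i j :
  definable (fun V e => suitable (e i) stage (e j)).
Proof.
  refine (definable_suitable (fun V _ => stage) _ (fun n => n) i j).
  intros r i' j'. definable.
Qed.
#[export] Hint Resolve definable_suitable_stage : definable.

Lemma definable_truth i : definable (fun V e => truth (e i)).
Proof. unfold truth. definable. Qed.
#[export] Hint Resolve definable_truth : definable.

Section Construction.
Context {V : structure} (HV : ZFC_tau V).
Implicit Types w x y z b d k p q n t u Q : V.

(** Since the oracle [D^z] is 0 on column [z], only pairs of other columns
    matter. *)
Lemma outputs_zero_local (P P' : V -> Prop) z k p n q x d :
  (forall w, w ≺ d -> (exists x' y, is_pair w x' y /\ y <> z) -> (P w <-> P' w)) ->
  outputs_zero z k p n q x P d -> outputs_zero z k p n q x P' d.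
Proof.
  intros HP (s & a & i & y & Hs & Hc & H). exists s, a, i, y.
  split; [exact Hs|]. split; [|exact H].
  apply (computation_local HV (oracle P z)); [|exact Hc].
  intros w Hw b. unfold oracle.
  split; intros (x' & y' & Hxy & Hv); exists x', y'; (split; [exact Hxy|]);
    (destruct (classic (y' = z)) as [E|E];
     [|specialize (HP w Hw (ex_intro _ x' (ex_intro _ y' (conj Hxy E))))]);
    unfold char_value in *; tauto.
Qed.

Lemma extends_trans Q1 Q2 Q3 : extends Q1 Q2 -> extends Q2 Q3 -> extends Q1 Q3.
Proof.
  intros [H12 E12] [H23 E23].
  assert (Hlt : forall w, w ≺ Q1 -> w ≺ Q2).
  { intros w Hw. destruct (not_lt HV _ _ H12) as [<-|H]; auto.
    exact (lt_trans HV _ _ _ Hw H). }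
  split.
  - intros H. apply H23. auto.
  - intros w Hw. rewrite E23; auto.
Qed.

Lemma singleton_exists x : exists s, forall u, u ∈ s <-> u = x.
Proof.
  destruct (pairing _ HV x x) as [s Hs]. exists s. intros u. rewrite (Hs u). tauto.
Qed.

(** The diagonalization, with witness [x := Q0] and [w0 = (Q0, z)], which is
    undecided by [Q0] because a pair follows its components.  Whatever is
    added as a member to a condition also raises the condition above it. *)
Lemma extension_meets z k p n q Q0 : exists Q, extends Q0 Q /\ meets z k p n q Q.
Proof.
  destruct (pair_exists HV Q0 z) as [w0 Hw0].
  assert (HQw0 : Q0 ≺ w0) by apply (pair_lt HV w0 Q0 z Hw0).
  assert (Hlt := lt_trans HV). assert (Hirr := lt_irrefl HV). assert (Hmem := mem_lt HV).
  destruct (classic (exists Q2 d, extends Q0 Q2 /\ d ≺ Q2 /\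
    outputs_zero z k p n q Q0 (fun u => u ∈ Q2) d)) as [(Q2 & d & H2 & Hd & Hh)|Hn].
  (* [Q2] itself is added to lift the condition above [Q2] and hence above [d];
     even if it is a pair, it is undecided by [Q2] and lies beyond all queries
     of [d]. *)
  - destruct (adjoin_exists HV Q2 Q2) as [Q' HQ'].
    destruct (adjoin_exists HV Q' w0) as [Q HQ].
    assert (HQm : forall w, w ∈ Q <-> w ∈ Q2 \/ w = Q2 \/ w = w0)
      by (intros w; rewrite (HQ w), (HQ' w); tauto).
    assert (HQ2 : Q2 ≺ Q) by (apply Hmem, HQm; auto).
    exists Q. split; [split|exists Q0, w0; split; [exact Hw0|split; [|left]]].
    + intros HQ0. apply (proj1 H2). eauto.
    + intros w Hw. rewrite HQm, <- (proj2 H2 w Hw). split; [|tauto].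
      intros [H|[->| ->]]; auto.
      * now destruct (proj1 H2).
      * destruct (Hirr Q0). eauto.
    + apply Hmem, HQm. auto.
    + split; [apply HQm; auto|]. exists d. split; [eauto|].
      revert Hh. apply outputs_zero_local. intros w Hw (x' & y & Hxy & Hy).
      rewrite HQm. split; [tauto|]. intros [H|[->| ->]]; auto.
      * destruct (Hirr Q2). eauto.
      * destruct Hy. apply (pair_inj _ _ _ _ _ Hxy Hw0).
  (* Adding the singleton of [w0] decides [w0] without making it true. *)
  - destruct (singleton_exists w0) as [s Hs].
    destruct (adjoin_exists HV Q0 s) as [Q HQ].
    assert (Hw0s : w0 ≺ s) by (apply Hmem, Hs; auto).
    assert (HsQ : s ≺ Q) by (apply Hmem, HQ; auto).
    assert (HQ0 : extends Q0 Q).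
    { split.
      - intros H. apply (Hirr Q0). eauto.
      - intros w Hw. rewrite (HQ w). split; [|tauto]. intros [H| ->]; auto.
        destruct (Hirr Q0). eauto. }
    exists Q. split; [exact HQ0|]. exists Q0, w0. split; [exact Hw0|].
    split; [eauto|]. right. split.
    + intros H. apply HQ in H as [H|H].
      * apply (Hirr Q0). eauto.
      * rewrite <- H in Hw0s. exact (Hirr _ Hw0s).
    + intros Q' d HQ' Hd Hh. apply Hn. exists Q', d. split; [|auto].
      exact (extends_trans _ _ _ HQ0 HQ').
Qed.

Lemma tuple5_inj t z k p n q z' k' p' n' q' :
  is_tuple t [z; k; p; n; q] -> is_tuple t [z'; k'; p'; n'; q'] ->
  z = z' /\ k = k' /\ p = p' /\ n = n' /\ q = q'.
Proof.
  simpl. intros (t1 & (t2 & (t3 & (t4 & (t5 & _ & H5) & H4) & H3) & H2) & H1)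
    (t1' & (t2' & (t3' & (t4' & (t5' & _ & H5') & H4') & H3') & H2') & H1').
  destruct (pair_inj _ _ _ _ _ H1 H1') as [-> ->].
  destruct (pair_inj _ _ _ _ _ H2 H2') as [-> ->].
  destruct (pair_inj _ _ _ _ _ H3 H3') as [-> ->].
  destruct (pair_inj _ _ _ _ _ H4 H4') as [-> ->].
  destruct (pair_inj _ _ _ _ _ H5 H5') as [-> _]. auto.
Qed.

Lemma tuple_exists (l : list V) : exists t, is_tuple t l.
Proof.
  induction l as [|a l [t Ht]]; simpl.
  - apply (empty_exists HV).
  - destruct (pair_exists HV a t) as [t' Ht']. eauto.
Qed.

Lemma suitable_local t (A B : V -> V -> Prop) Q :
  (forall u w, u ≺ t -> (A u w <-> B u w)) -> suitable t A Q <-> suitable t B Q.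
Proof.
  intros H. unfold suitable. split; (intros [H1 H2]; split; [|exact H2]);
    intros u Q' Hu HA; apply (H1 u Q' Hu), H; auto.
Qed.

Lemma stage_problem c : recursion_problem precedes (fun V _ => step) V c.
Proof.
  split.
  - intros t. destruct (segment_exists HV t) as [S HS].
    destruct (adjoin_exists HV S t) as [T HT]. exists T. split; [apply HT; auto|].
    intros u v Hv Hu. apply HT. left. apply HS.
    apply HT in Hv as [Hv| ->]; [|exact Hu].
    apply HS in Hv. exact (lt_trans HV _ _ _ Hu Hv).
  - intros S HS. destruct (lt_minimal HV (fun V e v => v ∈ e 0)
      ltac:(intros r i; definable) (fun _ => S)) as (m & Hm & Hmin).
    { apply NNPP. intros Hn. apply HS. intros u Hu. eauto. }
    exists m. split; [exact Hm|]. intros u Hu Hum. exact (Hmin u Hum Hu).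
  - intros t A B Q HAB. unfold step, acceptable.
    assert (E : forall Q, suitable t A Q <-> suitable t B Q)
      by (intros Q'; now apply suitable_local).
    setoid_rewrite E. auto.
  - intros t A Q Q' [H Hm] [H' Hm'].
    destruct (tau_total _ HV Q Q') as [L|[E|L]]; [|exact E|].
    + now destruct (Hm' Q L).
    + now destruct (Hm Q' L).
  - intros t f T _ _.
    apply (lt_minimal HV (fun V e v => acceptable (e 1) (app (e 0)) v))
      with (e := scons f (fun _ => t)).
    + intros r i. unfold acceptable. definable.
    + unfold acceptable. cbn.
      destruct (classic (exists Q, suitable t (app f) Q)) as [[Q HQ]|Hn].
      * exists Q. auto.
      * exists t. auto.
Qed.

Lemma stage_exists t : exists Q, stage t Q.
Proof.
  refine (recursive_total precedes (fun V _ => step) _ _ HV _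
    (stage_problem (fun _ => t)) t).
  - intros r i' j'. apply definable_lt.
  - intros _. exact definable_step_app.
Qed.

Lemma stage_unique t Q Q' : stage t Q -> stage t Q' -> Q = Q'.
Proof. exact (recursive_unique _ _ HV _ (stage_problem (fun _ => t)) t Q Q'). Qed.

Lemma stage_step t Q : stage t Q -> step t stage Q.
Proof. exact (recursive_equation _ _ HV _ (stage_problem (fun _ => t)) t Q). Qed.

(** By induction along the well-ordering.  The earlier stages cohere, so the union
    of all of them, raised above each of them, is a common extension; it can
    be extended further to meet the task. *)
Lemma stage_suitable t Q : stage t Q -> suitable t stage Q.
Proof.
  apply NNPP. intros Hn.
  destruct (lt_minimal HV (fun V _ v => exists A, stage v A /\ ~ suitable v stage A)
    ltac:(intros r i; definable) (fun _ => t)) as (t0 & (Q1 & HQ1 & Hn1) & Hmin).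
  { exists t, Q. tauto. }
  clear t Q Hn. rename t0 into t.
  assert (IH : forall u Q, u ≺ t -> stage u Q -> suitable u stage Q).
  { intros u Q Hu HQ. apply NNPP. intros Hn. apply (Hmin u Hu). eauto. }
  destruct (stage_step t Q1 HQ1) as [[H|H] _]; [auto|]. apply H. clear Q1 HQ1 Hn1 Hmin H.
  destruct (segment_exists HV t) as [S HS].
  destruct (replacement_for HV (fun V _ => stage) ltac:(intros r i j; definable)
    (fun _ => t) S) as [Y HY].
  { intros u Q Q' _. apply stage_unique. }
  (* [Y] is the set of earlier stages; as a member of [Q0] it puts [Q0] above all
     of them. *)
  destruct (union _ HV Y) as [Z HZ]. destruct (adjoin_exists HV Z Y) as [Q0 HQ0].
  assert (Hmem := mem_lt HV). assert (Hlt := lt_trans HV).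
  assert (Hext : forall u Q, u ≺ t -> stage u Q -> extends Q Q0).
  { intros u Q Hu HQ.
    assert (HQY : Q ≺ Y) by (apply Hmem, HY; exists u; split; [now apply HS|exact HQ]).
    assert (HY0 : Y ≺ Q0) by (apply Hmem, HQ0; auto). split.
    - intros HH. apply (lt_irrefl HV Q). eauto.
    - intros w Hw. rewrite (HQ0 w), HZ. split.
      + intros [(Q' & HwQ & HQ')| ->].
        * apply HY in HQ'. destruct HQ' as (u' & Hu' & HQ'). apply HS in Hu'.
          destruct (tau_total _ HV u u') as [L|[E|L]].
          -- apply (proj1 (IH u' Q' Hu' HQ') u Q L HQ); auto.
          -- rewrite E in HQ. now rewrite (stage_unique _ _ _ HQ HQ').
          -- apply (proj1 (IH u Q Hu HQ) u' Q' L HQ'); auto.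
        * destruct (lt_irrefl HV Y). eauto.
      + intros HwQ. left. exists Q. split; [exact HwQ|]. apply HY. exists u.
        split; [now apply HS|exact HQ]. }
  destruct (classic (exists z k p n q, is_tuple t [z; k; p; n; q])) as [Ht|Ht].
  - destruct Ht as (z & k & p & n & q & Ht).
    destruct (extension_meets z k p n q Q0) as (Q & HQ & Hm). exists Q. split.
    + intros u Q' Hu HQ'. exact (extends_trans _ _ _ (Hext u Q' Hu HQ') HQ).
    + intros z' k' p' n' q' Ht'.
      destruct (tuple5_inj _ _ _ _ _ _ _ _ _ _ _ Ht Ht') as (<- & <- & <- & <- & <-).
      exact Hm.
  - exists Q0. split; [exact Hext|]. intros z k p n q Ht'. destruct Ht. eauto 6.
Qed.

Lemma truth_stage t Q w : stage t Q -> w ≺ Q -> truth w <-> w ∈ Q.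
Proof.
  intros HQ Hw. split.
  - intros (t' & Q' & HQ' & HwQ).
    destruct (tau_total _ HV t t') as [L|[E|L]].
    + now apply (proj1 (stage_suitable t' Q' HQ') t Q L HQ).
    + rewrite E in HQ. now rewrite (stage_unique _ _ _ HQ HQ').
    + apply (proj1 (stage_suitable t Q HQ) t' Q' L HQ'); auto. now apply (mem_lt HV).
  - now exists t, Q.
Qed.

(** The condition that records the final truth values below a set beyond both
    [Q] and [d]. *)
Lemma truth_extension t Q d : stage t Q -> exists Q',
  extends Q Q' /\ d ≺ Q' /\ forall w, w ≺ d -> (truth w <-> w ∈ Q').
Proof.
  intros HQ.
  assert (Hm : exists m, ~ m ≺ Q /\ ~ m ≺ d).
  { assert (Hirr := lt_irrefl HV). assert (Hlt := lt_trans HV).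
    destruct (tau_total _ HV Q d) as [L|[E|L]].
    - exists d. split; auto. intros H. apply (Hirr Q). eauto.
    - exists d. subst. auto.
    - exists Q. split; auto. intros H. apply (Hirr Q). eauto. }
  destruct Hm as (m & HmQ & Hmd).
  destruct (segment_exists HV m) as [S HS].
  destruct (separation_for HV (fun V _ => truth) ltac:(intros r i; definable)
    (fun _ => m) S) as [X HX].
  destruct (adjoin_exists HV X m) as [Q' HQ'].
  assert (HmQ' : m ≺ Q') by (apply (mem_lt HV), HQ'; auto).
  assert (Hle : forall a w, ~ m ≺ a -> w ≺ a -> w ≺ m /\ w <> m).
  { intros a w Hma Hw. split; [|intros ->; auto].
    destruct (not_lt HV _ _ Hma) as [<-|H]; auto. exact (lt_trans HV _ _ _ Hw H). }
  assert (Htruth : forall w, w ≺ m /\ w <> m -> (truth w <-> w ∈ Q')).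
  { intros w [Hw Hne]. rewrite (HQ' w), HX, HS. tauto. }
  exists Q'. repeat split.
  - intros H. apply HmQ. exact (lt_trans HV _ _ _ HmQ' H).
  - intros Hw. apply (truth_stage t Q w HQ H), Htruth; eauto.
  - intros Hw. apply Htruth; eauto. apply (truth_stage t Q w HQ H), Hw.
  - destruct (not_lt HV _ _ Hmd) as [->|H]; auto. exact (lt_trans HV _ _ _ H HmQ').
  - intros Hw. apply Htruth; eauto.
  - intros Hw. apply Htruth; eauto.
Qed.

(** If the stage of the task made [w] true, its computation survives, being
    decided by that stage.  If it made [w] false, a computation relative to
    the final predicate would be one relative to some extension of the stage,
    and these were excluded. *)
Lemma requirement_met z k p n q : exists x w, is_pair w x z /\
  (truth w <-> exists d, outputs_zero z k p n q x truth d).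
Proof.
  destruct (tuple_exists [z; k; p; n; q]) as [t Ht]. destruct (stage_exists t) as [Q HQ].
  destruct (proj2 (stage_suitable t Q HQ) z k p n q Ht) as (x & w & Hw & HwQ & Hcase).
  exists x, w. split; [exact Hw|]. rewrite (truth_stage t Q w HQ HwQ).
  destruct Hcase as [(Hin & d & Hd & Hh)|(Hout & Hno)].
  - split; [intros _|auto]. exists d. revert Hh. apply outputs_zero_local.
    intros u Hu _. symmetry. apply (truth_stage t Q u HQ). exact (lt_trans HV _ _ _ Hu Hd).
  - split; [tauto|]. intros [d Hh]. exfalso.
    destruct (truth_extension t Q d HQ) as (Q' & HQ' & Hd & Htr).
    apply (Hno Q' d HQ' Hd). revert Hh. apply outputs_zero_local. auto.
Qed.

End Construction.

Lemma char_value_iff {V : structure} (P Q : Prop) (b : V) :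
  (P <-> Q) -> char_value P b <-> char_value Q b.
Proof. unfold char_value. tauto. Qed.

Theorem theorem25 :
  exists D : formula,
    forall V : structure, ZFC_tau V ->
      forall z : V,
        ~ computable_in (char1 (slice (defined_by D) z))
                        (char2 (erase (defined_by D) z)).
Proof.
  assert (HD : definable (fun V e => exists w, is_pair w (e 0) (e 1) /\ truth w))
    by definable.
  destruct HD as [D HD]. exists D. intros V HV z (k & p & n & q & _ & _ & _ & _ & _ & Hf).
  assert (Hdef : forall w x y : V, is_pair w x y -> (defined_by D x y <-> truth w)).
  { intros w x y Hw. unfold defined_by. rewrite HD. simpl. split; [|eauto].
    intros (w' & Hw' & H). now rewrite (pair_unique HV w w' x y Hw Hw'). }
  destruct (requirement_met HV z k p n q) as (x & w & Hw & Hdiag).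
  destruct (empty_exists HV) as [o Ho]. specialize (Hf x o).
  unfold char1, slice in Hf. rewrite (char_value_iff _ _ o (Hdef w x z Hw)) in Hf.
  assert (Ho1 : ~ is_numeral 1 o).
  { intros (y & _ & Hy). apply (Ho y), Hy. auto. }
  assert (Hor : forall u b : V, oracle truth z u b <-> char2 (erase (defined_by D) z) u b).
  { intros u b. unfold oracle, char2, erase.
    split; intros (x' & y' & Hxy & Hv); exists x', y'; (split; [exact Hxy|]);
      revert Hv; apply char_value_iff; now rewrite (Hdef u x' y' Hxy). }
  assert (Hhalt : (exists d, outputs_zero z k p n q x truth d) <-> exists s, is_input s x n q /\
    halts_with (char2 (erase (defined_by D) z)) k p s o).
  { split.
    - intros (d & s & a & i & y & Hs & Hc & Hi & Hy & Hyo). exists s. split; [exact Hs|].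
      exists a, d, i. split; [|split; [exact Hi|]].
      + revert Hc. apply (computation_local HV). intros u _. apply Hor.
      + rewrite (set_ext HV o y); [exact Hy|].
        intros u; split; intros Hu; [destruct (Ho u)|destruct (Hyo u)]; auto.
    - intros (s & Hs & a & d & i & Hc & Hi & Hy). exists d, s, a, i, o.
      split; [exact Hs|]. split; [|auto].
      revert Hc. apply (computation_local HV). intros u _ b. now rewrite Hor. }
  rewrite <- Hhalt, <- Hdiag in Hf.
  assert (Ho0 : is_numeral 0 o) by exact Ho.
  (* On [x], the value 0 is correct iff [D x z] fails and output iff it holds. *)
  unfold char_value in Hf. tauto.
Qed.
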